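(* For every integer $q_0>1$, the numbers $q_0,q_1,\dots,q_N$ produced by the construction described in the context satisfy $$\lambda(q_0):=\sum_{k=0}^{N}\frac{1}{\log_{10}q_k}<\frac{3}{\log_{10}q_0}.$$ Consequently, Lehmer's measure of the resulting Machin-like formula can be made arbitrarily small by the choice of $q_0$ alone: for every real $\eta>0$ there is an integer $q_0>1$ with $\lambda(q_0)<\eta$.
   Context: For real $x$, $\lfloor x\rceil$ denotes the nearest integer to $x$, with exact halves rounded up; $\operatorname{sign}(x)\in\{-1,0,1\}$ is the usual sign function. The Lehmer measure of a Machin-like formula $\frac{\pi}{4}=\sum_{k=0}^N m_k\arctan\frac{1}{q_k}$ (with $m_k\in\mathbb{Z}$, $q_k\in\mathbb{N}$) is $\lambda=\sum_{k=0}^N \frac{1}{\log_{10}q_k}$. Construction. Let $q_0>1$ be an integer. Put $m=\left\lfloor \frac{\pi/4}{\arctan(1/q_0)}\right\rceil$. Define integers $a_k,b_k$ by $a_0=b_0=1$ and, for $k\ge 0$, $a_{k+1}=q_0a_k-b_k$, $b_{k+1}=q_0b_k+a_k$. Put $A_1=|a_m|$, $B_1=b_m$, $\delta_1=\operatorname{sign}(a_m)$. For $n\ge 1$, as long as $A_n>0$, define $$q_n=\left\lfloor \frac{B_n}{A_n}\right\rceil,\qquad A_{n+1}=|q_nA_n-B_n|,\qquad B_{n+1}=q_nB_n+A_n,\qquad \delta_{n+1}=\delta_n\operatorname{sign}(q_nA_n-B_n).$$ The construction stops as soon as $A_{n+1}=0$; the nonnegative integers $A_n$ are strictly decreasing,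 so this happens after finitely many steps. $N\ge 1$ denotes the last index with $A_N>0$ (so $A_{N+1}=0$). The resulting Machin-like formula is $\frac{\pi}{4}=m\arctan\frac{1}{q_0}+\sum_{n=1}^N\delta_n\arctan\frac{1}{q_n}$. *)

(* Defs.v *)
From Stdlib Require Import Reals ZArith Lia.

(** Nearest integer, exact halves rounded up. *)
Definition round (x : R) : Z := Zfloor (x + 1 / 2)%R.

(** The multiplier [m] of [arctan (1/q0)]; it is positive when [q0 > 1], so
    [Z.to_nat] in [st] below loses nothing. *)
Definition mult (q0 : Z) : Z := round ((PI / 4) / atan (1 / IZR q0)).

(** The pair [(a_k, b_k)]. *)
Fixpoint ab (q0 : Z) (k : nat) : Z * Z :=
  match k with
  | O => (1, 1)%Z
  | S k' => let (a, b) := ab q0 k' in (q0 * a - b, q0 * b + a)%Z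
  end.

Record state := State { st_A : Z; st_B : Z; st_delta : Z }.

(** The integer [q_n] computed from [(A_n, B_n)]. *)
Definition quot (s : state) : Z := round (IZR (st_B s) / IZR (st_A s)).

Definition next (s : state) : state :=
  let (A, B, d) := s in
  let q := quot s in
  State (Z.abs (q * A - B)) (q * B + A) (d * Z.sgn (q * A - B)).

(** [st q0 i] is the triple [(A_n, B_n, delta_n)] with [n = i + 1].  It is
    meaningful only while [A_1, ..., A_i] are all positive: the recursion itself
    does not stop at a zero remainder, [last_index] below does. *)
Fixpoint st (q0 : Z) (i : nat) : state :=
  match i with
  | O => let (a, b) := ab q0 (Z.to_nat (mult q0)) in
         State (Z.abs a) b (Z.sgn a)
  | S i' => next (st q0 i')
  end.

(** [A_n] for [n >= 1]; the value at [n = 0] is never used. *)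
Definition A (q0 : Z) (n : nat) : Z := st_A (st q0 (n - 1)).

Definition q (q0 : Z) (n : nat) : Z :=
  match n with
  | O => q0
  | S i => quot (st q0 i)
  end.

Definition coef (q0 : Z) (n : nat) : Z :=
  match n with
  | O => mult q0
  | S i => st_delta (st q0 i)
  end.

(** [N] is the index at which the construction stops. *)
Definition last_index (q0 : Z) (N : nat) : Prop :=
  (1 <= N)%nat /\
  (forall n : nat, (1 <= n <= N)%nat -> (0 < A q0 n)%Z) /\
  A q0 (N + 1) = 0%Z.

Lemma last_index_unique (q0 : Z) (N N' : nat) :
  last_index q0 N -> last_index q0 N' -> N = N'.
Proof.
  intros [h1 [hp hz]] [h1' [hp' hz']].
  destruct (Nat.lt_trichotomy N N') as [h | [h | h]]; [ | exact h | ].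
  - assert (0 < A q0 (N + 1))%Z by (apply hp'; lia). lia.
  - assert (0 < A q0 (N' + 1))%Z by (apply hp; lia). lia.
Qed.

(** The identity [PI / 4 = c_0 arctan (1/q_0) + ... + c_N arctan (1/q_N)];
    [sum_f_R0 f N] has the [N + 1] terms [f 0, ..., f N]. *)
Definition machin_formula (N : nat) (c q : nat -> Z) : Prop :=
  (PI / 4)%R = sum_f_R0 (fun k => IZR (c k) * atan (1 / IZR (q k)))%R N.

(** Lehmer's measure.  A denominator [q k = 1] would contribute [1 / 0 = 0], so
    statements about it should come with [1 < q k]. *)
Definition lehmer_measure (N : nat) (q : nat -> Z) : R :=
  sum_f_R0 (fun k => 1 / Rlog 10 (IZR (q k)))%R N.

(* Main.v *)
Require Import Defs.
From Stdlib Require Import Reals ZArith.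
From Stdlib Require Import Znumtheory Lra Lia.

(** The triples [(A_n, B_n, delta_n)] run a greedy expansion of the angle
    [PI/4 - m * atan (1/q0)]: at each stage the angle left over is
    [delta_n * atan (A_n / B_n)].

    The pairs [(a_k, b_k)] are the Gaussian integers [(1 + i) * (q0 + i)^k],
    so [a_k / b_k] is the tangent of [PI/4 - k * atan (1/q0)]
    ([ab_polar]).  Since [m] is a nearest integer, that angle is at most
    [atan (1/q0) / 2] in absolute value for [k = m], whence [B_1 / A_1 >= q0] and [q_1 >= q0].
    It is not zero ([ab_fst_neq0]): modulo [q0^2 + 1] the number [q0] is a
    square root of [-1], and sending [i] to [q0] and to [-q0] shows that
    [a_k = 0], with [k >= 1], would make [q0^2 + 1] divide
    [(2 q0)^k (q0 + 1)].  An odd divisor of [q0^2 + 1] is coprime to [2], [q0]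
    and [q0 + 1], so it would be a unit; but [q0^2 + 1 > 2] is not divisible
    by [4], hence not a power of two.

    Rounding to the nearest integer gives [A_(n+1) <= A_n / 2], so the
    construction stops, and also [B_(n+1) / A_(n+1) >= 2 (q_n B_n / A_n + 1)],
    which forces [q_(n+1) >= q_n^2] ([quot_next]).  Thus the logarithms of
    [q_1, q_2, ...] at least double at every step, and the sum of their inverses
    is less than [1/log q0 + (1/log q0) (1 + 1/2 + 1/4 + ...)], that is
    [3/log q0] ([doubling_inverse_sum]).  The formula for [PI/4] is the
    telescoping sum of the addition formulas for the arctangent
    ([atan_peel]). *)

(** * Rounding *)

Lemma round_bounds (x : R) : (x - 1 / 2 < IZR (round x) <= x + 1 / 2)%R.
Proof. unfold round; pose proof (Zfloor_bound (x + 1 / 2)); lra. Qed.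

Lemma round_ge (z : Z) (x : R) : (IZR z <= x)%R -> (z <= round x)%Z.
Proof. intros h; apply Zfloor_lub; lra. Qed.

Lemma quot_bounds (s : state) :
  (0 < st_A s ->
   2 * st_B s - st_A s < 2 * (quot s * st_A s) <= 2 * st_B s + st_A s)%Z.
Proof.
  intros hA; pose proof (IZR_lt _ _ hA) as hA'; unfold quot.
  pose proof (round_bounds (IZR (st_B s) / IZR (st_A s))) as [h1 h2].
  apply (Rmult_lt_compat_r _ _ _ hA') in h1.
  apply (Rmult_le_compat_r _ _ _ (Rlt_le _ _ hA')) in h2.
  assert (e : (IZR (st_B s) / IZR (st_A s) * IZR (st_A s) = IZR (st_B s))%R)
    by (field; lra).
  split; [apply lt_IZR | apply le_IZR];
    rewrite ?minus_IZR, ?plus_IZR, !mult_IZR; lra.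
Qed.

(** * One step of the construction *)

Lemma next_A (s : state) :
  st_A (next s) = Z.abs (quot s * st_A s - st_B s).
Proof. now destruct s. Qed.

Lemma next_B (s : state) : st_B (next s) = (quot s * st_B s + st_A s)%Z.
Proof. now destruct s. Qed.

Lemma next_delta (s : state) :
  st_delta (next s) = (st_delta s * Z.sgn (quot s * st_A s - st_B s))%Z.
Proof. now destruct s. Qed.

Lemma next_A_half (s : state) :
  (0 < st_A s -> 0 <= 2 * st_A (next s) <= st_A s)%Z.
Proof. intros h; rewrite next_A; pose proof (quot_bounds s h); lia. Qed.

Lemma next_B_pos (s : state) :
  (0 < st_A s -> 0 < st_B s -> 1 <= quot s -> 0 < st_B (next s))%Z.
Proof. intros hA hB hq; rewrite next_B; nia. Qed.

(** Write [x = B/A] and [q] for its rounding.  The next ratio is at least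
    [2 (q x + 1)], hence at least [2 q^2 - q + 2], and rounding loses at most
    [1/2]; this leaves more than [q^2 - 1]. *)
Lemma quot_next (s : state) :
  (0 < st_A s -> 1 <= quot s -> 0 < st_A (next s) ->
   quot s * quot s <= quot (next s))%Z.
Proof.
  intros hA hq hA'.
  pose proof (quot_bounds s hA) as [_ h1].
  pose proof (next_A_half s hA) as h2.
  pose proof (quot_bounds (next s) hA') as [h3 _].
  rewrite next_B in h3.
  set (q := quot s) in *; set (q' := quot (next s)) in *.
  set (A := st_A s) in *; set (B := st_B s) in *.
  set (A' := st_A (next s)) in *.
  destruct (Z.le_gt_cases (q * q) q') as [h | h]; [exact h | exfalso].
  assert (k1 : (q' * (2 * A') <= (q * q - 1) * A)%Z).
  { apply Z.le_trans with ((q * q - 1) * (2 * A'))%Z.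
    - apply Z.mul_le_mono_nonneg_r; lia.
    - apply Z.mul_le_mono_nonneg_l; nia. }
  assert (k2 : (q * (2 * (q * A)) <= q * (2 * B + A))%Z)
    by (apply Z.mul_le_mono_nonneg_l; lia).
  assert (k3 : (0 <= (q - 1) * (q - 1) * A)%Z) by nia.
  assert (k4 : (0 <= q * A)%Z) by nia.
  nia.
Qed.

Lemma sgn_mul_atan (z : Z) (y : R) :
  (IZR (Z.sgn z) * atan (IZR (Z.abs z) / y) = atan (IZR z / y))%R.
Proof.
  destruct (Z.lt_trichotomy z 0) as [h | [h | h]].
  - rewrite Z.sgn_neg, Z.abs_neq, opp_IZR by lia.
    replace (- IZR z / y)%R with (- (IZR z / y))%R by (unfold Rdiv; ring).
    rewrite atan_opp; ring.
  - subst z; simpl; unfold Rdiv; rewrite !Rmult_0_l, atan_0; reflexivity.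
  - rewrite Z.sgn_pos, Z.abs_eq by lia; ring.
Qed.

Lemma atan_pos (x : R) : (0 < x)%R -> (0 < atan x)%R.
Proof. intros h; rewrite <- atan_0; now apply atan_increasing. Qed.

(** The addition formula for [atan (A/B) - atan (1/q)], whose tangent is
    [(q A - B) / (q B + A)]. *)
Lemma atan_peel (s : state) :
  (0 < st_A s)%Z -> (0 < st_B s)%Z -> (1 <= quot s)%Z ->
  (IZR (st_delta s) * atan (IZR (st_A s) / IZR (st_B s)) =
   IZR (st_delta s) * atan (1 / IZR (quot s)) +
   IZR (st_delta (next s)) *
     atan (IZR (st_A (next s)) / IZR (st_B (next s))))%R.
Proof.
  intros hA hB hq.
  rewrite next_A, next_B, next_delta, mult_IZR, Rmult_assoc, sgn_mul_atan.
  rewrite minus_IZR, plus_IZR, !mult_IZR.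
  apply IZR_lt in hA, hB; apply IZR_le in hq.
  set (x := IZR (st_A s)) in *; set (y := IZR (st_B s)) in *.
  set (q := IZR (quot s)) in *.
  rewrite <- Rmult_plus_distr_l; f_equal.
  assert (hu : (0 < x / y)%R) by (apply Rdiv_lt_0_compat; lra).
  assert (hv : (0 < 1 / q)%R) by (apply Rdiv_lt_0_compat; lra).
  replace ((q * x - y) / (q * y + x))%R with (atan_sub (x / y) (1 / q)).
  - apply atan_sub_correct.
    + pose proof (Rmult_lt_0_compat _ _ hu hv); lra.
    + pose proof (atan_bound (x / y)); pose proof (atan_bound (1 / q)).
      pose proof (atan_pos _ hu); pose proof (atan_pos _ hv); lra.
    + apply atan_bound.
  - unfold atan_sub; field; repeat split; nra.
Qed.

(** * The starting pair *)

(** As [cos t = q0 * sin t] for [t = atan (1/q0)], multiplying by [q0 + i]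
    turns an argument by [t] and divides the modulus by [sin t]. *)
Lemma ab_polar (q0 : Z) (k : nat) :
  (1 < q0)%Z ->
  let t := atan (1 / IZR q0) in
  exists r : R, (0 < r)%R /\
    IZR (fst (ab q0 k)) = (r * sin (PI / 4 - INR k * t))%R /\
    IZR (snd (ab q0 k)) = (r * cos (PI / 4 - INR k * t))%R.
Proof.
  intros hq t; apply IZR_lt in hq.
  assert (hv : (0 < 1 / IZR q0)%R) by (apply Rdiv_lt_0_compat; lra).
  assert (ht : (0 < t)%R) by (now apply atan_pos).
  pose proof (atan_bound (1 / IZR q0)) as hb; fold t in hb.
  assert (hs : (0 < sin t)%R) by (apply sin_gt_0; lra).
  assert (hc : (0 < cos t)%R) by (apply cos_gt_0; lra).
  assert (e : (cos t = IZR q0 * sin t)%R).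
  { assert (e0 : (sin t / cos t = 1 / IZR q0)%R) by (apply tan_atan).
    replace (sin t) with (sin t / cos t * cos t)%R by (field; lra).
    rewrite e0; field; lra. }
  induction k as [ | k [r [hr [ea eb]]]].
  - assert (h4 : (0 < cos (PI / 4))%R) by (apply cos_gt_0; lra).
    exists (/ cos (PI / 4))%R; split; [now apply Rinv_0_lt_compat | ].
    simpl; replace (PI / 4 - 0 * t)%R with (PI / 4)%R by ring.
    rewrite sin_cos_PI4; split; field; lra.
  - exists (r / sin t)%R; split; [now apply Rdiv_lt_0_compat | ].
    replace (PI / 4 - INR (S k) * t)%R with ((PI / 4 - INR k * t) - t)%R
      by (rewrite S_INR; ring).
    set (phi := (PI / 4 - INR k * t)%R) in *.
    rewrite sin_minus, cos_minus, e.
    simpl; destruct (ab q0 k) as [a b]; simpl in *.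
    rewrite minus_IZR, plus_IZR, !mult_IZR, ea, eb; split; field; lra.
Qed.

(** The images of [(1 + i) * (q0 + i)^k] under the two ring morphisms from the
    Gaussian integers to the integers modulo [q0^2 + 1], which send [i] to [-q0]
    and to [q0]; the former kills [q0 + i]. *)
Lemma ab_mod (q0 : Z) (k : nat) :
  let a := fst (ab q0 (S k)) in
  let b := snd (ab q0 (S k)) in
  ((q0 * q0 + 1 | a - q0 * b) /\
   (q0 * q0 + 1 | a + q0 * b - (2 * q0) ^ Z.of_nat (S k) * (1 + q0)))%Z.
Proof.
  assert (h : forall n, (q0 * q0 + 1 | fst (ab q0 n) + q0 * snd (ab q0 n)
                           - (2 * q0) ^ Z.of_nat n * (1 + q0))%Z).
  { induction n as [ | n [c IH]].
    - exists 0%Z; rewrite Z.pow_0_r; cbn [ab fst snd]; ring.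
    - exists (2 * q0 * c - snd (ab q0 n))%Z.
      rewrite Nat2Z.inj_succ, Z.pow_succ_r by lia.
      cbn [ab]; destruct (ab q0 n) as [a b]; cbn [fst snd] in *.
      transitivity (2 * q0 * (a + q0 * b - (2 * q0) ^ Z.of_nat n * (1 + q0))
                    - b * (q0 * q0 + 1))%Z; [ring | rewrite IH; ring]. }
  split; [ | apply h].
  exists (- snd (ab q0 k))%Z; simpl; destruct (ab q0 k); simpl; ring.
Qed.

(** Squares are [0] or [1] modulo [4], so dividing by [2] when [q0] is odd
    leaves an odd divisor, which is not a unit. *)
Lemma square_plus_one_odd_divisor (q0 : Z) :
  (1 < q0)%Z ->
  exists E j : Z, (1 < E /\ E = 2 * j + 1 /\ (E | q0 * q0 + 1))%Z.
Proof.
  intros hq; destruct (Z.Even_or_Odd q0) as [[h e] | [h e]].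
  - exists (q0 * q0 + 1)%Z, (2 * h * h)%Z; repeat split; [nia | | ].
    + subst q0; ring.
    + apply Z.divide_refl.
  - exists (2 * (h * h + h) + 1)%Z, (h * h + h)%Z; repeat split; [nia | ].
    exists 2%Z; subst q0; ring.
Qed.

Lemma ab_fst_neq0 (q0 : Z) (k : nat) :
  (1 < q0)%Z -> fst (ab q0 k) <> 0%Z.
Proof.
  intros hq; destruct k as [ | k]; [easy | intros ha].
  destruct (ab_mod q0 k) as [h1 h2]; rewrite ha in h1, h2.
  destruct (square_plus_one_odd_divisor q0 hq) as [E [j [hE [ej [c ec]]]]].
  assert (h : (E | (2 * q0) ^ Z.of_nat (S k) * (1 + q0))%Z).
  { apply Z.divide_trans with (q0 * q0 + 1)%Z; [now exists c | ].
    destruct h1 as [u e1], h2 as [v e2]; exists (- u - v)%Z; lia. }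
  assert (r2 : rel_prime E 2).
  { apply bezout_rel_prime, Bezout_intro with (u := 1%Z) (v := (- j)%Z); lia. }
  assert (rq : rel_prime E q0).
  { apply bezout_rel_prime, Bezout_intro with (u := c) (v := (- q0)%Z); lia. }
  (* [q0^2 + 1 = (q0 - 1) (q0 + 1) + 2], so a common divisor of [E] and
     [q0 + 1] divides [2], while [E] is odd *)
  assert (rs : rel_prime E (1 + q0)).
  { apply bezout_rel_prime,
      Bezout_intro with (u := (1 - j * c)%Z) (v := (j * (q0 - 1))%Z).
    transitivity (E - j * (c * E) + j * (q0 - 1) * (1 + q0))%Z; [ring | ].
    rewrite <- ec, ej; ring. }
  assert (r : rel_prime E ((2 * q0) ^ Z.of_nat (S k) * (1 + q0))).
  { apply rel_prime_mult; [ | exact rs].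
    apply Zpow_facts.rel_prime_Zpower_r; [lia | now apply rel_prime_mult]. }
  destruct r as [_ _ r].
  assert (E1 : (E | 1)%Z) by (apply r; [apply Z.divide_refl | exact h]).
  apply Z.divide_1_r in E1; lia.
Qed.

Lemma mult_remainder (q0 : Z) :
  (1 < q0)%Z ->
  let t := atan (1 / IZR q0) in
  (0 < t)%R /\ (0 <= mult q0)%Z /\
  (- (t / 2) <= PI / 4 - IZR (mult q0) * t <= t / 2)%R.
Proof.
  intros hq t; apply IZR_lt in hq.
  assert (ht : (0 < t)%R) by (apply atan_pos, Rdiv_lt_0_compat; lra).
  split; [exact ht | ].
  pose proof (round_bounds (PI / 4 / t)) as [h1 h2].
  change (round (PI / 4 / t)) with (mult q0) in h1, h2.
  assert (hp : (0 < PI / 4 / t)%R)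
    by (apply Rdiv_lt_0_compat; pose proof PI_RGT_0; lra).
  split.
  - assert (-1 < mult q0)%Z by (apply lt_IZR; lra); lia.
  - assert (e : (PI / 4 = PI / 4 / t * t)%R) by (field; lra).
    rewrite e; nra.
Qed.

Lemma st0_spec (q0 : Z) :
  (1 < q0)%Z ->
  (0 < st_A (st q0 0))%Z /\ (0 < st_B (st q0 0))%Z /\
  (q0 * st_A (st q0 0) <= st_B (st q0 0))%Z /\
  (PI / 4 = IZR (mult q0) * atan (1 / IZR q0) +
     IZR (st_delta (st q0 0)) *
       atan (IZR (st_A (st q0 0)) / IZR (st_B (st q0 0))))%R.
Proof.
  intros hq.
  destruct (mult_remainder q0 hq) as [ht [hm hphi]].
  destruct (ab_polar q0 (Z.to_nat (mult q0)) hq) as [r [hr [ea eb]]].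
  pose proof (ab_fst_neq0 q0 (Z.to_nat (mult q0)) hq) as hne.
  rewrite INR_IZR_INZ, Z2Nat.id in ea, eb by exact hm.
  pose proof (atan_bound (1 / IZR q0)) as hb.
  pose proof (tan_atan (1 / IZR q0)) as etan.
  simpl; destruct (ab q0 (Z.to_nat (mult q0))) as [a b]; simpl in *.
  set (t := atan (1 / IZR q0)) in *.
  set (phi := (PI / 4 - IZR (mult q0) * t)%R) in *.
  assert (hc : (0 < cos phi)%R) by (apply cos_gt_0; lra).
  assert (hB : (0 < IZR b)%R) by (rewrite eb; now apply Rmult_lt_0_compat).
  assert (eab : (IZR a / IZR b = tan phi)%R)
    by (rewrite ea, eb; unfold tan; field; lra).
  repeat split; [lia | now apply lt_IZR | | ].
  - apply IZR_lt in hq.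
    assert (h1 : (tan phi < 1 / IZR q0)%R)
      by (rewrite <- etan; apply tan_increasing; lra).
    assert (h2 : (- (1 / IZR q0) < tan phi)%R).
    { rewrite <- etan, <- tan_neg; apply tan_increasing; lra. }
    assert (e : (IZR a = tan phi * IZR b)%R) by (rewrite <- eab; field; lra).
    assert (e' : (1 / IZR q0 * IZR q0 = 1)%R) by (field; lra).
    assert (h3 : (IZR q0 * tan phi < 1)%R) by nra.
    assert (h4 : (-1 < IZR q0 * tan phi)%R) by nra.
    apply le_IZR; rewrite mult_IZR, abs_IZR.
    destruct (Rle_or_lt 0 (IZR a)) as [k | k];
      [rewrite Rabs_right by lra | rewrite Rabs_left by lra]; rewrite e; nra.
  - rewrite sgn_mul_atan, eab, atan_tan by lra.
    unfold phi; ring.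
Qed.

(** * Termination and the telescoping sum *)

Lemma first_zero (u : nat -> Z) :
  (forall n, 0 < u n -> 0 <= u (S n) < u n)%Z -> (0 < u 0%nat)%Z ->
  exists M : nat, (forall i, (i <= M)%nat -> (0 < u i)%Z) /\ u (S M) = 0%Z.
Proof.
  remember (Z.to_nat (u 0%nat)) as c eqn:ec.
  assert (hc : (u 0%nat <= Z.of_nat c)%Z) by lia; clear ec.
  revert u hc; induction c as [ | c IH]; intros u hc hu h0; [lia | ].
  pose proof (hu 0%nat h0) as h1.
  destruct (Z.eq_dec (u 1%nat) 0) as [e | ne].
  - exists 0%nat; split; [ | exact e].
    intros i hi; now replace i with 0%nat by lia.
  - destruct (IH (fun n => u (S n))) as [M [hM eM]]; [lia | | lia | ].
    + intros n; apply hu.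
    + exists (S M); split; [ | exact eM].
      intros [ | i] hi; [exact h0 | apply hM; lia].
Qed.

Lemma st_invariant (q0 : Z) (M : nat) :
  (1 < q0)%Z -> (forall i, (i <= M)%nat -> (0 < st_A (st q0 i))%Z) ->
  forall i, (i <= M)%nat ->
    (0 < st_B (st q0 i) /\ q0 <= quot (st q0 i))%Z.
Proof.
  intros hq hpos; induction i as [ | i IH]; intros hi.
  - destruct (st0_spec q0 hq) as [hA [hB [hAB _]]]; split; [exact hB | ].
    apply round_ge.
    apply IZR_lt in hA; apply IZR_le in hAB; rewrite mult_IZR in hAB.
    apply Rmult_le_reg_r with (IZR (st_A (st q0 0))); [exact hA | ].
    unfold Rdiv; rewrite Rmult_assoc, Rinv_l, Rmult_1_r by lra; exact hAB.
  - destruct IH as [hB hQ]; [lia | ].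
    pose proof (hpos i ltac:(lia)) as hA.
    pose proof (hpos (S i) hi) as hA'; simpl in hA' |- *.
    split; [apply next_B_pos; lia | ].
    pose proof (quot_next (st q0 i) hA ltac:(lia) hA'); nia.
Qed.

Lemma machin_partial (q0 : Z) (M : nat) :
  (1 < q0)%Z -> (forall i, (i <= M)%nat -> (0 < st_A (st q0 i))%Z) ->
  forall n, (n <= S M)%nat ->
  (PI / 4 =
   sum_f_R0 (fun k => IZR (coef q0 k) * atan (1 / IZR (q q0 k))) n +
   IZR (st_delta (st q0 n)) *
     atan (IZR (st_A (st q0 n)) / IZR (st_B (st q0 n))))%R.
Proof.
  intros hq hpos; induction n as [ | n IH]; intros hn.
  - simpl sum_f_R0; simpl coef; simpl q; apply st0_spec, hq.
  - rewrite IH by lia; rewrite tech5, Rplus_assoc; f_equal.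
    destruct (st_invariant q0 M hq hpos n ltac:(lia)) as [hB hQ].
    apply atan_peel; [apply hpos; lia | exact hB | lia].
Qed.

(** * Lehmer's measure *)

(** Doubling makes [3/l_0 - 1/l_n] an upper bound for the [n]th partial sum, the
    term [1/l_n] being what the remaining geometric series could still add. *)
Lemma doubling_inverse_sum (l : nat -> R) (N : nat) :
  (1 <= N)%nat -> (0 < l 0%nat)%R -> (l 0%nat <= l 1%nat)%R ->
  (forall n, (1 <= n < N)%nat -> (2 * l n <= l (S n))%R) ->
  (sum_f_R0 (fun k => 1 / l k) N < 3 / l 0%nat)%R.
Proof.
  intros hN h0 h1 hd.
  assert (H : forall n, (S n <= N)%nat ->
    (0 < l (S n))%R /\
    (sum_f_R0 (fun k => 1 / l k) (S n) <= 3 / l 0%nat - 1 / l (S n))%R).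
  { induction n as [ | n IH]; intros hn.
    - split; [lra | ].
      pose proof (Rinv_le_contravar _ _ h0 h1).
      simpl; unfold Rdiv; lra.
    - destruct IH as [hp hs]; [lia | ].
      pose proof (hd (S n) ltac:(lia)) as h2.
      split; [lra | ].
      assert (hp2 : (0 < 2 * l (S n))%R) by lra.
      pose proof (Rinv_le_contravar _ _ hp2 h2) as h3.
      rewrite Rinv_mult in h3.
      rewrite tech5; unfold Rdiv in *; lra. }
  destruct N as [ | n]; [lia | ].
  destruct (H n (le_n _)) as [hp hs].
  pose proof (Rinv_0_lt_compat _ hp); unfold Rdiv in *; lra.
Qed.

Lemma Rlog10_pos (x : R) : (1 < x)%R -> (0 < Rlog 10 x)%R.
Proof.
  intros h; unfold Rlog; apply Rdiv_lt_0_compat;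
    rewrite <- ln_1; apply ln_increasing; lra.
Qed.

Lemma Rlog10_le (x y : R) : (0 < x <= y)%R -> (Rlog 10 x <= Rlog 10 y)%R.
Proof.
  intros [h [h' | ->]]; [ | lra].
  unfold Rlog, Rdiv; apply Rmult_le_compat_r.
  - left; apply Rinv_0_lt_compat; rewrite <- ln_1; apply ln_increasing; lra.
  - left; now apply ln_increasing.
Qed.

Lemma Rlog10_square (x : R) :
  (0 < x)%R -> (Rlog 10 (x * x) = 2 * Rlog 10 x)%R.
Proof. intros h; unfold Rlog; rewrite ln_mult by exact h; unfold Rdiv; ring. Qed.

Lemma machin_run (q0 : Z) :
  (1 < q0)%Z ->
  exists N : nat,
    last_index q0 N /\
    machin_formula N (coef q0) (q q0) /\
    (forall k : nat, (k <= N)%nat -> (1 < q q0 k)%Z) /\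
    (lehmer_measure N (q q0) < 3 / Rlog 10 (IZR q0))%R.
Proof.
  intros hq.
  destruct (first_zero (fun i => st_A (st q0 i))) as [M [hpos hz]].
  { intros n hn; pose proof (next_A_half (st q0 n) hn); simpl; lia. }
  { apply st0_spec, hq. }
  pose proof (st_invariant q0 M hq hpos) as hinv.
  assert (hgt : forall k, (k <= S M)%nat -> (1 < q q0 k)%Z).
  { intros [ | k] hk; simpl; [exact hq | ].
    destruct (hinv k); lia. }
  exists (S M); repeat split.
  - lia.
  - intros n hn; apply hpos; lia.
  - unfold A; replace (S M + 1 - 1)%nat with (S M) by lia; exact hz.
  - unfold machin_formula.
    rewrite (machin_partial q0 M hq hpos (S M) (le_n _)), hz at 1.
    unfold Rdiv at 2; rewrite Rmult_0_l, atan_0; ring.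
  - exact hgt.
  - unfold lehmer_measure.
    apply (doubling_inverse_sum (fun k => Rlog 10 (IZR (q q0 k)))).
    + lia.
    + apply Rlog10_pos, IZR_lt, hq.
    + apply Rlog10_le; split; [apply IZR_lt; simpl; lia | ].
      apply IZR_le, (hinv 0%nat); lia.
    + intros [ | n] hn; [lia | ].
      pose proof (hgt (S n) ltac:(lia)) as h1.
      assert (hp : (0 < IZR (q q0 (S n)))%R) by (apply IZR_lt; lia).
      rewrite <- Rlog10_square by exact hp.
      apply Rlog10_le; split; [now apply Rmult_lt_0_compat | ].
      rewrite <- mult_IZR; apply IZR_le; simpl in h1 |- *.
      apply quot_next; [apply hpos; lia | lia | apply (hpos (S n)); lia].
Qed.

Theorem mainTheorem2 :
  (forall q0 : Z, (1 < q0)%Z ->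
     exists N : nat,
       last_index q0 N /\
       machin_formula N (coef q0) (q q0) /\
       (forall k : nat, (k <= N)%nat -> (1 < q q0 k)%Z) /\
       (lehmer_measure N (q q0) < 3 / Rlog 10 (IZR q0))%R) /\
  (forall eta : R, (0 < eta)%R ->
     exists q0 : Z, (1 < q0)%Z /\
       exists N : nat,
         last_index q0 N /\
         (lehmer_measure N (q q0) < eta)%R).
Proof.
  split; [exact machin_run | ].
  intros eta heta.
  (* any integer above [10^(3/eta)] works *)
  set (x := exp (3 / eta * ln 10)).
  assert (h10 : (0 < ln 10)%R) by (rewrite <- ln_1; apply ln_increasing; lra).
  assert (h3 : (0 < 3 / eta)%R) by (apply Rdiv_lt_0_compat; lra).
  assert (hx : (1 < x)%R).
  { unfold x; rewrite <- exp_0; apply exp_increasing, Rmult_lt_0_compat; lra. }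
  assert (hq : (x < IZR (up x))%R) by apply archimed.
  assert (hq1 : (1 < up x)%Z) by (apply lt_IZR; lra).
  exists (up x); split; [exact hq1 | ].
  destruct (machin_run (up x) hq1) as [N [hN [_ [_ hl]]]].
  exists N; split; [exact hN | ].
  apply Rlt_le_trans with (1 := hl).
  assert (hlog : (3 / eta <= Rlog 10 (IZR (up x)))%R).
  { replace (3 / eta)%R with (Rlog 10 x).
    - apply Rlog10_le; lra.
    - unfold Rlog, x; rewrite ln_exp; field; lra. }
  pose proof (Rinv_le_contravar _ _ h3 hlog) as h.
  replace (/ (3 / eta))%R with (eta / 3)%R in h by (field; lra).
  unfold Rdiv at 1; lra.
Qed.
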